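(* Let $n\geq 2$ and let $B_n$ be the braid group on $n$ strands with standard generators $g_1,\ldots,g_{n-1}$. For an integer $k\geq 1$ let $B_n[k]$ denote the normal subgroup of $B_n$ generated by $g_1^k,\ldots,g_{n-1}^k$. Then $\bigcap_{k\geq 1} B_n[k]=\{1\}$.
   Context: $B_n$ has the standard Artin presentation with generators $g_1,\ldots,g_{n-1}$, relations $g_ig_{i+1}g_i=g_{i+1}g_ig_{i+1}$ and $g_ig_j=g_jg_i$ for $|i-j|\geq 2$. *)

(* Defs.v *)
(* The braid group B_n is encoded by its Artin presentation:
   elements are words in the letters g_i^{+1}, g_i^{-1} (i : 'I_(n.-1), where
   index i stands for the generator g_{i+1}), modulo the congruence generated
   by free cancellation and the braid relations. *)
From mathcomp Require Import all_boot.
Set Implicit Arguments. Unset Strict Implicit. Unset Printing Implicit Defensive.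

(* a letter (i, true) = g_{i+1}, (i, false) = g_{i+1}^{-1} *)
Definition letter (n : nat) := ('I_n.-1 * bool)%type.
Definition word (n : nat) := seq (letter n).

Definition inv_letter n (x : letter n) : letter n := (x.1, ~~ x.2).
Definition inv_word n (w : word n) : word n := rev (map (@inv_letter n) w).

Inductive braid_rel (n : nat) : word n -> word n -> Prop :=
  | br_free (x : letter n) : braid_rel [:: x; inv_letter x] [::]
  | br_braid (i j : 'I_n.-1) : j = i.+1 :> nat ->
      braid_rel [:: (i, true); (j, true); (i, true)]
                [:: (j, true); (i, true); (j, true)]
  | br_comm (i j : 'I_n.-1) : i.+2 <= j ->
      braid_rel [:: (i, true); (j, true)] [:: (j, true); (i, true)].

Inductive braid_eq (n : nat) : word n -> word n -> Prop :=
  | be_refl w : braid_eq w w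
  | be_sym u v : braid_eq u v -> braid_eq v u
  | be_trans u v w : braid_eq u v -> braid_eq v w -> braid_eq u w
  | be_step (u v r s : word n) : braid_rel r s ->
      braid_eq (u ++ r ++ v) (u ++ s ++ v).

(* words that are products of conjugates of g_i^k and g_i^{-k}; these represent
   exactly the elements of the normal closure of {g_1^k, ..., g_{n-1}^k} *)
Inductive ncl_word (n k : nat) : word n -> Prop :=
  | nw_nil : @ncl_word n k [::]
  | nw_cons (u w : word n) (i : 'I_n.-1) (b : bool) : @ncl_word n k w ->
      @ncl_word n k (u ++ nseq k (i, b) ++ inv_word u ++ w).

Definition in_Bnk (n k : nat) (w : word n) : Prop :=
  exists w', braid_eq w w' /\ @ncl_word n k w'.

(* Main.v *)
(* B_n acts on G^n for every finite group G by the Hurwitz moves (x_i,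
   x_(i+1)) |-> (x_i x_(i+1) x_i^-1, x_i).  This action is by permutations of
   a finite set, hence factors through a group of finite exponent k; then
   B_n[k] acts trivially, and it remains to see that a braid acting trivially
   for all finite G is trivial.

   Every braid can be combed as [carry * a * b], where [carry] moves one
   strand to the last position, [a] is a word in the loops of the last strand
   around the others, and [b] does not involve the last strand.  The last
   coordinate shows that [carry] is trivial.  On tuples whose last entry is 1
   the loops act trivially, so [b] acts trivially and is trivial by
   induction.  Finally, [a] conjugates the last entry x by an element which
   is [a] evaluated at the other entries, modulo the normal closure of x.  If
   [a] is a nonempty reduced word, choose permutations of a finite set X at
   which [a] evaluates to an element moving some point p, lift them to X *
   bool, and let x be the swap of the fibre over p: then x is changed by [a]. *)
From HB Require Import structures.
Require Import Defs.
From mathcomp Require Import all_boot.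
From mathcomp Require Import fingroup perm cyclic generic_quotient boolp zify.
Set Implicit Arguments. Unset Strict Implicit. Unset Printing Implicit Defensive.
Local Open Scope group_scope.
Local Open Scope quotient_scope.

(** * Signed words, their values in groups, and free reduction *)

Notation sletter := (nat * bool)%type.

Definition flip (l : sletter) : sletter := (l.1, ~~ l.2).

Definition lval (B : groupType) (s : nat -> B) (l : sletter) : B :=
  if l.2 then s l.1 else (s l.1)^-1.

Definition weval (B : groupType) (s : nat -> B) (w : seq sletter) : B :=
  \prod_(l <- w) lval s l.

Definition below (m : nat) (w : seq sletter) := all (fun l => l.1 < m) w.

(** Such a family amounts to a homomorphism to [B] from the braid group with [m] generators, that
    is, on [m.+1] strands. Identities proved for all braided families serve both the abstract braid
    group and its finite quotients. *)
Definition braided (m : nat) (B : groupType) (s : nat -> B) : Prop :=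
  (forall i, i.+1 < m -> s i * s i.+1 * s i = s i.+1 * s i * s i.+1) /\
  (forall i j, i.+1 < j < m -> s i * s j = s j * s i).

Lemma braidedW m n (B : groupType) (s : nat -> B) :
  m <= n -> braided n s -> braided m s.
Proof.
move=> mn [sb sc]; split=> [i im|i j /andP[ij jm]].
  exact/sb/(leq_trans im).
by apply: sc; rewrite ij (leq_trans jm).
Qed.

Lemma lval_flip (B : groupType) (s : nat -> B) l :
  lval s (flip l) = (lval s l)^-1.
Proof. by case: l => i [] //=; rewrite /lval /= invgK. Qed.

Lemma weval_nil (B : groupType) (s : nat -> B) : weval s [::] = 1.
Proof. exact: big_nil. Qed.

Lemma weval_cons (B : groupType) (s : nat -> B) l w :
  weval s (l :: w) = lval s l * weval s w.
Proof. exact: big_cons. Qed.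

Lemma weval_cat (B : groupType) (s : nat -> B) u v :
  weval s (u ++ v) = weval s u * weval s v.
Proof. exact: big_cat. Qed.

Lemma weval1 (B : groupType) (s : nat -> B) l : weval s [:: l] = lval s l.
Proof. by rewrite weval_cons weval_nil mulg1. Qed.

Lemma weval_inv (B : groupType) (s : nat -> B) w :
  weval s (rev (map flip w)) = (weval s w)^-1.
Proof.
elim: w => [|l w IHw] /=; first by rewrite !weval_nil invg1.
by rewrite rev_cons -cats1 weval_cat weval1 IHw lval_flip weval_cons invgM.
Qed.

Lemma below_inv m w : below m (rev (map flip w)) = below m w.
Proof. by rewrite /below all_rev all_map; apply: eq_all. Qed.

Definition reduced (w : seq sletter) := sorted (fun l l' => l' != flip l) w.

(** A letter added on the left either cancels the head or leaves the word reduced. The word is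
    chosen before the group, so one reduction serves all groups. *)
Lemma reduce_word m w : below m w -> exists w', [/\ below m w', reduced w' &
  forall (B : groupType) (s : nat -> B), weval s w = weval s w'].
Proof.
elim: w => [|l w IHw] /= => [_|/andP[lm /IHw[w' [w'm w'r ww']]]].
  by exists [::].
have [ht|/negbTE hf] := boolP (if w' is l' :: _ then l' == flip l else false).
  case: w' w'm w'r ww' ht => //= l' t /andP[_ tm] lt ww' /eqP l'E.
  exists t; split=> //; first exact: path_sorted lt.
  move=> B s; rewrite weval_cons ww' weval_cons l'E lval_flip mulgA mulgV.
  exact: mul1g.
exists (l :: w'); split=> /=; first by rewrite lm.
  by case: w' w'r hf {w'm ww'} => //= l' t -> ->.
by move=> B s; rewrite !weval_cons ww'.
Qed.

(** * Carries, loops and the combing of braids *)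

(* The braid moving strand j to position m. *)
Definition carry (B : groupType) (s : nat -> B) (m j : nat) : B :=
  \prod_(j <= i < m) s i.

(* The pure braid in which strand m winds once around strand j. *)
Definition loop (B : groupType) (s : nat -> B) (m j : nat) : B :=
  (s j * s j) ^ carry s m j.+1.

Lemma carryE (B : groupType) (s : nat -> B) m j :
  j < m -> carry s m j = s j * carry s m j.+1.
Proof. exact: big_ltn. Qed.

Lemma carry_top (B : groupType) (s : nat -> B) m : carry s m m = 1.
Proof. exact: big_geq. Qed.

Lemma carry_comm (B : groupType) (s : nat -> B) m i j :
  braided m s -> i.+1 < j -> commute (s i) (carry s m j).
Proof.
move=> [_ sc] ij; rewrite /carry big_seq_cond.
apply: commute_prod => k; rewrite mem_index_iota => /andP[/andP[jk km] _].
by apply: sc; rewrite (leq_trans ij jk).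
Qed.

(** The letter [s i.+1] commutes with the factors before [s i], becomes [s i] by one braid relation,
    and then commutes with the rest. *)
Lemma carry_shift (B : groupType) (s : nat -> B) m i j :
  braided m s -> j <= i -> i.+1 < m ->
  s i.+1 * carry s m j = carry s m j * s i.
Proof.
move=> sB ji im; move: (sB) => [sb sc].
elim: {j}(i - j) {-2}j (erefl (i - j)) ji => [|d IHd] j ijd ji.
  have -> : j = i by lia.
  rewrite (carryE s (ltnW im)) (carryE s im).
  rewrite -!mulgA -(carry_comm sB (ltnSn _)).
  by rewrite !mulgA sb.
rewrite carryE; last lia.
have -> : s i.+1 * (s j * carry s m j.+1) = s j * (s i.+1 * carry s m j.+1).
  by rewrite !mulgA -(sc j i.+1) //; lia.
by rewrite IHd ?mulgA //; lia.
Qed.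

(** For [i.+1 < j] every factor commutes with [s i]. For [j < i], [s i] is the conjugate of [s i.+1]
    by the carry that defines the loop, and [s i.+1] commutes with [s j]. *)
Lemma loop_comm (B : groupType) (s : nat -> B) m i j :
  braided m s -> i.+1 < m -> j < m -> (i.+1 < j) || (j < i) ->
  s i * loop s m j = loop s m j * s i.
Proof.
move=> sB im jm; have [_ sc] := sB.
rewrite /loop => /orP[ij|ji].
  have c1 : commute (s i) (carry s m j.+1) by apply: carry_comm => //; lia.
  have c2 : commute (s i) (s j) by apply: sc; rewrite ij.
  apply: commuteM; first exact: commuteV.
  by apply: commuteM => //; apply: commuteM.
have c : commute (s i.+1) (s j * s j).
  by apply: commuteM; apply/commute_sym/sc; lia.
have -> : s i = s i.+1 ^ carry s m j.+1.
  by rewrite conjgE (carry_shift sB ji im) mulKg.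
by rewrite -!conjMg c.
Qed.

(** Both loops are conjugates by the carry from [i.+2], which commutes with [s i], so an identity in
    two adjacent generators suffices. *)
Lemma loop_up (B : groupType) (s : nat -> B) m i :
  braided m s -> i.+1 < m -> s i * loop s m i.+1 = loop s m i * s i.
Proof.
move=> sB im; have [sb _] := sB.
rewrite /loop (carryE s im).
have c : commute (s i) (carry s m i.+2) by apply: carry_comm.
set M := carry _ _ _ in c *; set a := s i in c *; set b := s i.+1.
have ab : a * b * a = b * a * b by apply: sb.
have E : a * (b * b) = (a * a) ^ b * a.
  rewrite conjgE; apply: (mulgI b); rewrite !mulgA mulgV mul1g.
  by rewrite -ab -!mulgA; congr (_ * _); rewrite !mulgA ab.
have aM : a ^ M = a by rewrite conjgE c mulKg.
by rewrite conjgM -{1 4}aM -!conjMg E.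
Qed.

(** Up to conjugation by [M], the product is [b * a * a * b], through which two braid relations
    carry [a]. Together with [loop_up] this determines how [s i] conjugates loop [i]. *)
Lemma loop_mul_comm (B : groupType) (s : nat -> B) m i :
  braided m s -> i.+1 < m -> commute (s i) (loop s m i.+1 * loop s m i).
Proof.
move=> sB im; have [sb _] := sB.
rewrite /loop (carryE s im) conjgM -conjMg.
have c : commute (s i) (carry s m i.+2) by apply: carry_comm.
set a := s i in c *; set b := s i.+1; set M := carry _ _ _ in c *.
suff e : commute a (b * b * (a * a) ^ b).
  have aM : a ^ M = a by rewrite conjgE c mulKg.
  by move: (congr1 (conjg^~ M) e); rewrite /= !(conjMg _ _ M) aM.
rewrite /commute.
have ab : a * b * a = b * a * b by apply: sb.
rewrite conjgE !mulgA !mulgK.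
by rewrite ab -!mulgA; congr (_ * (_ * _)); rewrite !mulgA ab.
Qed.

(** Generators not involving the last strand normalise the subgroup generated by the loops; the
    conjugates are explicit words, the same in every group. *)
Lemma push_loop m i b j : i.+1 < m -> j < m ->
  exists2 a, below m a & forall (B : groupType) (s : nat -> B), braided m s ->
    lval s (i, b) * loop s m j = weval (loop s m) a * lval s (i, b).
Proof.
move=> im jm; have i'm := ltnW im.
have [-> {j jm}|jni] := eqVneq j i.
  case: b.
    (* With [L], [L'] the loops [i] and [i.+1], [s i * L' = L * s i] and the commutation of [s i]
       with [L' * L] give the conjugate [L^-1 * L' * L]. *)
    exists [:: (i, false); (i.+1, true); (i, true)]; first by rewrite /= i'm im.
    move=> B s sB; rewrite !weval_cons weval_nil mulg1 /lval /=.
    move: (loop_up sB im) (loop_mul_comm sB im).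
    move: (loop s m i) (loop s m i.+1) => L L' up c.
    by apply: (mulgI L); rewrite !mulgA mulgV mul1g -up -[LHS]mulgA c.
  exists [:: (i.+1, true)]; first by rewrite /= im.
  move=> B s sB; rewrite weval1 /lval /=.
  move: (loop_up sB im); move: (loop s m i) (loop s m i.+1) => L L' up.
  by apply: (mulgI (s i)); rewrite !mulgA mulgV mul1g up mulgK.
have [-> {j jm jni}|jni'] := eqVneq j i.+1.
  case: b.
    exists [:: (i, true)]; first by rewrite /= i'm.
    by move=> B s sB; rewrite weval1 /lval /= loop_up.
  exists [:: (i.+1, true); (i, true); (i.+1, false)].
    by rewrite /= i'm im.
  move=> B s sB; rewrite !weval_cons weval_nil mulg1 /lval /=.
  move: (loop_up sB im) (loop_mul_comm sB im).
  move: (loop s m i) (loop s m i.+1) => L L' up c.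
  apply: (mulgI (s i)); rewrite !mulgA mulgV mul1g -(mulgA (s i)) c.
  apply: (mulIg (s i)); rewrite mulgVK; apply: (mulIg L'); rewrite mulgVK.
  by rewrite -mulgA up !mulgA.
exists [:: (j, true)]; first by rewrite /= jm.
move=> B s sB; rewrite weval1 /lval /=.
have c : commute (s i) (loop s m j) by apply: loop_comm => //; lia.
by case: b => //; apply/commute_sym/commuteV/commute_sym.
Qed.

Lemma push_loops m l a : l.1.+1 < m -> below m a ->
  exists2 a', below m a' & forall (B : groupType) (s : nat -> B), braided m s ->
    lval s l * weval (loop s m) a = weval (loop s m) a' * lval s l.
Proof.
case: l => i b /= im; elim: a => [_|[j c] a IHa /= /andP[jm /IHa[a' a'm ha']]].
  by exists [::] => // B s _; rewrite !weval_nil mulg1 mul1g.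
have [u um hu] := push_loop b im jm.
exists ((if c then u else rev (map flip u)) ++ a').
  rewrite /below all_cat -![all _ _]/(below m _) (fun_if (below m)).
  by rewrite below_inv um if_same.
move=> B s sB; rewrite weval_cons weval_cat.
rewrite mulgA -[RHS]mulgA -(ha' _ _ sB) [RHS]mulgA; congr (_ * _).
have {hu} := hu _ _ sB; case: c => //; rewrite weval_inv [lval _ (j, _)]/lval /=.
move: (loop s m j) (lval s (i, b)) (weval _ u) => L x v e.
by apply: (mulgI v); rewrite !mulgA mulgV mul1g -e mulgK.
Qed.

Lemma weval_below_eq (B : groupType) (s s' : nat -> B) m w :
  (forall i, i < m -> s i = s' i) -> below m w -> weval s w = weval s' w.
Proof.
by move=> ss'; elim: w => [|l w IHw] /= => [_|/andP[lm /IHw]];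
  rewrite ?weval_nil // !weval_cons /lval ss' // => ->.
Qed.

(* The elements of this form are stable under left multiplication by the
   generators and their inverses. *)
Lemma comb_word m w : below m w -> exists j a b,
  [/\ j <= m, below m a, reduced a, below m.-1 b &
   forall (B : groupType) (s : nat -> B), braided m s ->
     weval s w = carry s m j * weval (loop s m) a * weval s b].
Proof.
move=> wm; suff [j [a [b [jm am bm wE]]]] : exists j a b,
    [/\ j <= m, below m a, below m.-1 b &
     forall (B : groupType) (s : nat -> B), braided m s ->
       weval s w = carry s m j * weval (loop s m) a * weval s b].
  have [a' [a'm ra' aE]] := reduce_word am.
  by exists j, a', b; split=> // B s sB; rewrite wE // aE.
elim: w wm => [_|[i c] w IHw /= /andP[im /IHw[j [a [b [jm am bm wE]]]]]].
  exists m, [::], [::]; split=> // B s _.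
  by rewrite carry_top !weval_nil !mulg1.
(* Here [s i] extends the carry to start at [i]; its inverse does so too, at the price of an inverse
   loop [i]. *)
have [ij|ij] := eqVneq i.+1 j.
  subst j; case: c; first exists i, a, b.
    split=> //; first exact: ltnW.
    by move=> B s sB; rewrite weval_cons wE // (carryE s im) /lval /= !mulgA.
  exists i, ((i, false) :: a), b; split=> //; rewrite ?(ltnW im) //= ?im //.
  move=> B s sB; rewrite !weval_cons wE // (carryE s im) /lval /= /loop.
  by rewrite conjgE !invgM !invgK !mulgA mulgK mulgV mul1g.
(* Now the inverse of [s i] shortens the carry, while [s i] shortens it and leaves a loop [i]. *)
have [ij'|ij'] := eqVneq i j.
  subst j; case: c; last exists i.+1, a, b.
    exists i.+1, ((i, true) :: a), b; split=> //=; first by rewrite im.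
    move=> B s sB; rewrite !weval_cons wE // (carryE s im) /lval /= /loop.
    by rewrite conjgE !mulgA mulgV mul1g.
  split=> // B s sB; rewrite weval_cons wE // (carryE s im) /lval /=.
  by rewrite !mulgA mulVg mul1g.
(* Otherwise the letter crosses the carry, keeping its index if [i < j] and losing one if [j < i].
   It then crosses the loops and joins [b]. *)
suff [k km hk] : exists2 k, k.+1 < m & forall (B : groupType) (s : nat -> B),
    braided m s -> s i * carry s m j = carry s m j * s k.
  have [a' a'm ha'] := push_loops (l := (k, c)) km am.
  exists j, a', ((k, c) :: b); split=> //=.
    by rewrite bm andbT; lia.
  move=> B s sB; rewrite !weval_cons wE // !mulgA.
  suff -> : lval s (i, c) * carry s m j = carry s m j * lval s (k, c).
    by rewrite -[X in X * _]mulgA ha' // !mulgA.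
  have := hk _ _ sB; rewrite /lval; case: c {ha'} => //= e.
  by apply: (mulgI (s i)); rewrite !mulgA mulgV mul1g e mulgK.
have [lt_ij|le_ji] := ltnP i j.
  exists i; first lia.
  by move=> B s sB; apply: carry_comm => //; lia.
case: i im ij ij' le_ji => [|i] im ij ij' le_ji; first lia.
by exists i => // B s sB; apply: carry_shift => //; lia.
Qed.

(** * The Hurwitz action on tuples over a finite group *)

Definition extend (N : nat) (B : groupType) (g : 'I_N -> B) (k : nat) : B :=
  if insub k is Some i then g i else 1.

Lemma extend_ord (N : nat) (B : groupType) (g : 'I_N -> B) (i : 'I_N) :
  extend g i = g i.
Proof. by rewrite /extend valK. Qed.

(** Natural indices avoid ordinal arithmetic. An index beyond [N] would read coordinate 0, hence the
    bounds [k <= N] below. *)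
Definition coord (N : nat) (T : Type) (x : {ffun 'I_N.+1 -> T}) (k : nat) : T :=
  x (inord k).

Lemma coord_ext (N : nat) (T : Type) (x y : {ffun 'I_N.+1 -> T}) :
  (forall k, k <= N -> coord x k = coord y k) -> x = y.
Proof.
move=> xy; apply/ffunP => k.
by move: (xy k (ltn_ord k)); rewrite /coord inord_val.
Qed.

Lemma coord_ffun (N : nat) (T : Type) (f : nat -> T) k : k <= N ->
  coord [ffun i : 'I_N.+1 => f i] k = f k.
Proof. by move=> kN; rewrite /coord ffunE inordK. Qed.

Definition hstep (gT : finGroupType) (N : nat) (i : 'I_N)
    (x : {ffun 'I_N.+1 -> gT}) : {ffun 'I_N.+1 -> gT} :=
  [ffun k : 'I_N.+1 =>
    if k == i :> nat then coord x i.+1 ^ (coord x i)^-1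
    else if k == i.+1 :> nat then coord x i else coord x k].

Lemma coord_hstep (gT : finGroupType) N (i : 'I_N) (x : {ffun 'I_N.+1 -> gT}) k :
  k <= N -> coord (hstep i x) k =
    if k == i then coord x i.+1 ^ (coord x i)^-1
    else if k == i.+1 then coord x i else coord x k.
Proof. by move=> kN; rewrite /coord ffunE inordK. Qed.

Lemma hstep_inj (gT : finGroupType) N (i : 'I_N) : injective (@hstep gT N i).
Proof.
move=> x y xy; have iN := ltn_ord i.
have {}xy k (kN : k <= N) := congr1 (@coord N gT ^~ k) xy.
have e1 : coord x i = coord y i.
  by have := xy _ iN; rewrite /= !coord_hstep // (gtn_eqF (ltnSn _)) eqxx.
have e2 : coord x i.+1 = coord y i.+1.
  have := xy _ (ltnW iN); rewrite /= !coord_hstep ?(ltnW iN) // eqxx e1.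
  exact: conjg_inj.
apply: coord_ext => k kN; have := xy _ kN; rewrite /= !coord_hstep //.
by case: eqP => [->|_] //; case: eqP => [->|_].
Qed.

Definition hurwitz (gT : finGroupType) (N : nat) :
    nat -> {perm {ffun 'I_N.+1 -> gT}} :=
  extend (fun i : 'I_N => perm (@hstep_inj gT N i)).
Arguments hurwitz : clear implicits.

Lemma coord_hurwitz (gT : finGroupType) N i (x : {ffun 'I_N.+1 -> gT}) k :
  i < N -> k <= N -> coord (hurwitz gT N i x) k =
    if k == i then coord x i.+1 ^ (coord x i)^-1
    else if k == i.+1 then coord x i else coord x k.
Proof.
move=> iN kN.
have := extend_ord (fun j : 'I_N => perm (@hstep_inj gT N j)) (Ordinal iN).
by rewrite /hurwitz /= => ->; rewrite permE coord_hstep.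
Qed.

Lemma coord_hurwitzV (gT : finGroupType) N i (x : {ffun 'I_N.+1 -> gT}) k :
  i < N -> k <= N -> coord ((hurwitz gT N i)^-1 x) k =
    if k == i then coord x i.+1
    else if k == i.+1 then coord x i ^ coord x i.+1 else coord x k.
Proof.
move=> iN kN; set y := _ x; have -> : x = hurwitz gT N i y by rewrite permKV.
rewrite !coord_hurwitz ?(ltnW iN) // eqxx (gtn_eqF (ltnSn _)) eqxx.
by case: eqP => [->|_] //; case: eqP => [->|_] //; rewrite conjgKV.
Qed.

Lemma hurwitz_braided (gT : finGroupType) N : braided N (hurwitz gT N).
Proof.
split=> [i iN|i j /andP[ij jN]]; apply/permP => x; apply: coord_ext => k kN;
  rewrite !permM.
  have E := coord_hurwitz; rewrite !{}E ?(ltnW iN) //; try lia.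
  have F : ((i == i.+1) = false) * ((i.+1 == i) = false) *
    ((i == i.+2) = false) * ((i.+2 == i) = false) *
    ((i.+1 == i.+2) = false) * ((i.+2 == i.+1) = false) by do !split; lia.
  rewrite !(F, eqxx); case: (k =P i) => [->|ki].
    by rewrite !F !conjgE !invgM !invgK !mulgA !mulgVK.
  case: (k =P i.+1) => // ki1.
  by case: (k =P i.+2).
have E := coord_hurwitz; rewrite !{}E //; try lia.
have F : ((i == j) = false) * ((i.+1 == j) = false) *
  ((i == j.+1) = false) * ((i.+1 == j.+1) = false) *
  ((j == i) = false) * ((j == i.+1) = false) *
  ((j.+1 == i) = false) * ((j.+1 == i.+1) = false) by do !split; lia.
rewrite !F; case: (k =P i) => [->|ki]; first by rewrite !F.
by case: (k =P i.+1) => [->|ki1]; rewrite ?F.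
Qed.

(** Hurwitz moves use only products and inverses, so they are natural. A relation replaces a
    homomorphism because [lies_over] is defined on only some permutations of the cover. *)
Lemma hurwitz_rel (gT qT : finGroupType) (R : gT -> qT -> Prop) N w x y :
  (forall u v g h, R u g -> R v h -> R (u * v) (g * h)) ->
  (forall u g, R u g -> R u^-1 g^-1) ->
  below N w -> (forall k, k <= N -> R (coord x k) (coord y k)) ->
  forall k, k <= N -> R (coord (weval (hurwitz gT N) w x) k)
                        (coord (weval (hurwitz qT N) w y) k).
Proof.
move=> RM RV; have RJ u v g h : R u g -> R v h -> R (u ^ v) (g ^ h).
  by move=> ug vh; rewrite !conjgE;
    exact: (RM _ _ _ _ (RV _ _ vh) (RM _ _ _ _ ug vh)).
elim: w x y => [|[i b] w IHw] x y /= => [_|/andP[iN wN]] xy.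
  by rewrite !weval_nil !perm1.
rewrite !weval_cons !permM; apply: IHw => // k kN.
rewrite /lval /=; case: b.
  rewrite !coord_hurwitz //; case: eqP => _; last by case: eqP => _; apply: (xy); lia.
  by apply: (RJ); last apply: (RV); apply: (xy); lia.
rewrite !coord_hurwitzV //; case: eqP => _; first by apply: (xy); lia.
by case: eqP => _; [apply: (RJ)|]; apply: (xy); lia.
Qed.

Lemma hurwitz_fix (gT : finGroupType) N m w (x : {ffun 'I_N.+1 -> gT}) k :
  m <= N -> below m w -> m < k <= N ->
  coord (weval (hurwitz gT N) w x) k = coord x k.
Proof.
move=> mN wm mk; elim: w x wm => [|[i b] w IHw] x /= => [_|/andP[im wm]].
  by rewrite weval_nil perm1.
rewrite weval_cons permM IHw // /lval /=.
have [ki ki'] : (k == i) = false /\ (k == i.+1) = false by lia.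
by case: b; rewrite ?coord_hurwitz ?coord_hurwitzV ?ki ?ki' //; lia.
Qed.

Lemma carry_coord_top (gT : finGroupType) N m j (x : {ffun 'I_N.+1 -> gT}) :
  j <= m <= N -> coord (carry (hurwitz gT N) m j x) m = coord x j.
Proof.
case/andP=> jm mN; elim: {j}(m - j) {-2}j (erefl (m - j)) jm x => [|d IHd] j dE jm x.
  have -> : j = m by lia.
  by rewrite carry_top perm1.
rewrite carryE; last lia.
rewrite permM IHd; [|lia..]; rewrite coord_hurwitz; [|lia..].
by rewrite (gtn_eqF (ltnSn _)) eqxx.
Qed.

Lemma carry_coord_low (gT : finGroupType) N m j (x : {ffun 'I_N.+1 -> gT}) k :
  m <= N -> k < j <= m -> coord (carry (hurwitz gT N) m j x) k = coord x k.
Proof.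
move=> mN /andP[kj jm].
elim: {j}(m - j) {-2}j (erefl (m - j)) jm kj x => [|d IHd] j dE jm kj x.
  have -> : j = m by lia.
  by rewrite carry_top perm1.
rewrite carryE; last lia.
rewrite permM IHd; [|lia..]; rewrite coord_hurwitz; [|lia..].
by rewrite ltn_eqF // ltn_eqF // ltnW.
Qed.

Lemma loop_coord_top (gT : finGroupType) N m j (x : {ffun 'I_N.+1 -> gT}) :
  j < m <= N ->
  coord (loop (hurwitz gT N) m j x) m = coord x m ^ (coord x j)^-1.
Proof.
case/andP=> jm mN; rewrite /loop conjgE !permM.
(* Permutations compose from left to right, so the loop undoes the carry, applies [s j] twice and
   carries again. Entry [m] of [x] is entry [j.+1] of [y], and entry [j] is common to both. *)
set c := carry _ _ _; set y := c^-1 x.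
have -> : x = c y by rewrite permKV.
rewrite !carry_coord_top ?jm // carry_coord_low ?ltnSn //.
have jN : j < N by apply: leq_trans mN.
by rewrite !coord_hurwitz ?(ltnW jN) // (gtn_eqF (ltnSn _)) !eqxx.
Qed.

(** Two Hurwitz moves send the pair [(g, 1)] to [(1, g)] and back. *)
Lemma loop_id (gT : finGroupType) N m j (x : {ffun 'I_N.+1 -> gT}) :
  j < m <= N -> coord x m = 1 -> loop (hurwitz gT N) m j x = x.
Proof.
case/andP=> jm mN; rewrite /loop conjgE !permM.
set c := carry _ _ _; set y := c^-1 x.
have -> : x = c y by rewrite permKV.
rewrite carry_coord_top ?jm // => y1; congr (c _).
have jN : j < N by apply: leq_trans mN.
apply: coord_ext => k kN; rewrite !coord_hurwitz ?(ltnW jN) //.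
rewrite !(eqxx, gtn_eqF (ltnSn _)).
rewrite y1 conj1g invg1 conjg1.
by case: eqP => [->|_] //; case: eqP => [->|_].
Qed.

Lemma loops_id (gT : finGroupType) N m a (x : {ffun 'I_N.+1 -> gT}) :
  m <= N -> below m a -> coord x m = 1 ->
  weval (loop (hurwitz gT N) m) a x = x.
Proof.
move=> mN am x1; elim: a am => [|[j b] a IHa] /= => [_|/andP[jm am]].
  by rewrite weval_nil perm1.
have jmN : j < m <= N by rewrite jm.
rewrite weval_cons permM -[RHS]IHa //; congr (_ _).
rewrite /lval /=; case: b; first exact: loop_id.
by apply: (perm_inj (s := loop (hurwitz gT N) m j)); rewrite permKV loop_id.
Qed.

(** * Partial injections and reduced words acting on a finite set *)

Lemma perm_of_pairs (T : finType) (ps : seq (T * T)) :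
  {in ps &, forall u v, (u.1 == v.1) = (u.2 == v.2)} ->
  exists p : {perm T}, {in ps, forall u, p u.1 = u.2}.
Proof.
elim: ps => [_|u ps IHps ups]; first by exists 1.
have [v w vps wps|p pE] := IHps; first by apply: ups; rewrite inE ?vps ?wps orbT.
(* The transposition corrects the value at [u.1]; by injectivity it disturbs no value already
   prescribed. *)
exists (p * tperm (p u.1) u.2) => v; rewrite permM.
have [->|vu] := eqVneq v u; first by rewrite tpermL.
rewrite inE (negbTE vu) /= => vps.
have uv := ups u v (mem_head _ _); rewrite inE vps orbT in uv.
have [e1|n1] := eqVneq u.1 v.1.
  by rewrite -e1 tpermL; apply/eqP; rewrite -uv // e1.
rewrite (pE v vps) tpermD -?uv //.
by rewrite -(pE v vps) (inj_eq perm_inj).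
Qed.

(* Residual finiteness of free groups. *)
Lemma reduced_perm (a : seq sletter) : reduced a ->
  exists f : nat -> {perm 'I_(size a).+1}, weval f a ord0 = ord_max.
Proof.
move=> ra; set L := size a; pose a_ t := nth (0, true) a t.
(* The word is spelled along a path with vertices 0 to [L]; an inverse letter traverses its edge
   backwards. Each generator has to extend the edges that carry its label. *)
pose edge t : 'I_L.+1 * 'I_L.+1 :=
  if (a_ t).2 then (inord t, inord t.+1) else (inord t.+1, inord t).
have inordE t t' : t <= L -> t' <= L ->
    ((inord t : 'I_L.+1) == inord t') = (t == t').
  by move=> tL t'L; rewrite -val_eqE /= !inordK.
have aS t : t.+1 < L -> a_ t.+1 <> flip (a_ t).
  by move=> tL; apply/eqP; move/sortedP: ra; apply.
have fP j : exists p : {perm 'I_L.+1},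
    {in [seq edge t | t <- iota 0 L & (a_ t).1 == j], forall u, p u.1 = u.2}.
  apply: perm_of_pairs => u v /mapP[t + ->] /mapP[t' + ->].
  rewrite !mem_filter !mem_iota /= add0n.
  move=> /andP[/eqP tj tL] /andP[/eqP t'j t'L].
  (* Two edges with one label could share a source or a target only if they were consecutive with
     opposite signs, which reducedness forbids. *)
  have [n1 n2] : ~ (t' = t.+1 /\ (a_ t').2 = ~~ (a_ t).2) /\
                 ~ (t = t'.+1 /\ (a_ t').2 = ~~ (a_ t).2).
    split=> -[tt' b].
      by subst t'; apply: (aS t) => //; rewrite [LHS]surjective_pairing t'j b -tj.
    subst t; apply: (aS t') => //; rewrite [LHS]surjective_pairing tj.
    by rewrite /flip b negbK t'j.
  rewrite /edge; case: (a_ t).2 n1 n2; case: (a_ t').2 => /= n1 n2;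
    rewrite !inordE ?(ltnW tL) ?(ltnW t'L) ?eqSS //.
    have -> : (t == t'.+1) = false by apply/eqP => tt'; apply: n2.
    by apply/esym/eqP => tt'; apply: n1.
  have -> : (t.+1 == t') = false by apply/eqP => tt'; apply: n1.
  by apply/esym/eqP => tt'; apply: n2.
have [f fE] := choice fP.
have step t : t < L -> lval f (a_ t) (inord t) = inord t.+1.
  move=> tL; have := fE (a_ t).1 (edge t); rewrite /lval map_f; last first.
    by rewrite mem_filter eqxx mem_iota.
  move=> /(_ isT); rewrite /edge; case: (a_ t).2 => //= fE'.
  by apply: (perm_inj (s := f (a_ t).1)); rewrite permKV fE'.
exists f; suff H t : t <= L -> weval f (take t a) ord0 = inord t.
  rewrite -{1}(take_size a) H //.
  by apply: val_inj; rewrite /= inordK.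
elim: t => [_|t IHt tL].
  by rewrite take0 weval_nil perm1; apply: val_inj; rewrite /= inordK.
rewrite (take_nth (0, true)) // -cats1 weval_cat weval1 permM.
by rewrite IHt ?(ltnW tL) ?step.
Qed.

(** * Permutations of a two-sheeted cover, and loops acting on the last entry *)

Definition lies_over (T : finType) (u : {perm T * bool}) (g : {perm T}) : Prop :=
  forall z, (u z).1 = g z.1.

(** Such a [v] must be the swap of the two points over [p]; phrased by its support, it is easily
    followed through conjugations. *)
Definition moves_only (T : finType) (p : T) (v : {perm T * bool}) : Prop :=
  v <> 1 /\ forall z, z.1 <> p -> v z = z.

Lemma lies_over1 (T : finType) : lies_over (1 : {perm T * bool}) 1.
Proof. by move=> z; rewrite !perm1. Qed.

Lemma lies_overM (T : finType) (u v : {perm T * bool}) (g h : {perm T}) :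
  lies_over u g -> lies_over v h -> lies_over (u * v) (g * h).
Proof. by move=> ug vh z; rewrite !permM vh ug. Qed.

Lemma lies_overV (T : finType) (u : {perm T * bool}) (g : {perm T}) :
  lies_over u g -> lies_over u^-1 g^-1.
Proof. by move=> ug z; apply: (perm_inj (s := g)); rewrite permKV -ug permKV. Qed.

Lemma moves_onlyJ (T : finType) (u v : {perm T * bool}) (g : {perm T}) p :
  lies_over u g -> moves_only p v -> moves_only (g p) (v ^ u).
Proof.
move=> ug [v1 vp]; split=> [vu|z zgp].
  by apply/v1/(@conjg_inj _ u); rewrite vu conj1g.
rewrite conjgE !permM vp ?permKV // (lies_overV ug) => zp.
by apply: zgp; rewrite -zp permKV.
Qed.

Lemma moves_only_uniq (T : finType) (v : {perm T * bool}) p q :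
  moves_only p v -> moves_only q v -> p = q.
Proof.
move=> [v1 vp] [_ vq]; have [//|/eqP pq] := eqVneq p q.
case: v1; apply/permP => z; rewrite perm1.
by have [zp|/eqP/vp //] := eqVneq z.1 p; apply: vq; rewrite zp.
Qed.

Lemma lift_perm_inj (T : finType) (g : {perm T}) :
  injective (fun z : T * bool => (g z.1, z.2)).
Proof. by move=> [z b] [z' b'] /= [/perm_inj -> ->]. Qed.

Lemma lift_lies_over (T : finType) (g : {perm T}) :
  lies_over (perm (lift_perm_inj (g := g))) g.
Proof. by move=> z; rewrite permE. Qed.

Lemma swap_lies_over (T : finType) (p : T) :
  lies_over (tperm (p, true) (p, false)) 1.
Proof. by move=> z; rewrite perm1; case: tpermP => // ->. Qed.

Lemma swap_moves_only (T : finType) (p : T) :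
  moves_only p (tperm (p, true) (p, false)).
Proof.
split=> [/permP/(_ (p, true))|z zp]; first by rewrite tpermL perm1.
by apply: tpermD; apply/eqP => zE; apply: zp; rewrite -zE.
Qed.

(** Unfolding the loops into generators makes [hurwitz_rel] applicable to loop words. *)
Lemma loops_word m a : below m a -> exists2 w, below m w &
  forall (B : groupType) (s : nat -> B), weval (loop s m) a = weval s w.
Proof.
elim: a => [_|[j b] a IHa /= /andP[jm /IHa[w wm aw]]].
  by exists [::] => // B s; rewrite !weval_nil.
pose c := [seq (i, true) | i <- index_iota j.+1 m].
have cm : below m c.
  by apply/allP => _ /mapP[i + ->] /=; rewrite mem_index_iota => /andP[].
have cE (B : groupType) (s : nat -> B) : weval s c = carry s m j.+1.
  by rewrite /weval big_map.
exists (rev (map flip c) ++ [:: (j, b); (j, b)] ++ c ++ w).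
  by rewrite /below !all_cat -!/(below m _) below_inv cm wm /= jm.
move=> B s; rewrite weval_cons aw !weval_cat weval_inv cE !mulgA; congr (_ * _).
rewrite !weval_cons weval_nil mulg1 /lval /= /loop conjgE.
by case: b; rewrite ?(invgM, invgK) !mulgA.
Qed.

Lemma loops_conj (gT : finGroupType) N m a (x : {ffun 'I_N.+1 -> gT}) :
  m <= N -> below m a ->
  exists u, coord (weval (loop (hurwitz gT N) m) a x) m = coord x m ^ u.
Proof.
move=> mN; elim: a x => [|[j b] a IHa] x /= => [_|/andP[jm am]].
  by exists 1; rewrite weval_nil perm1 conjg1.
rewrite weval_cons permM.
have [u ->] := IHa (lval (loop (hurwitz gT N) m) (j, b) x) am.
rewrite /lval /=; case: b.
  exists ((coord x j)^-1 * u); rewrite conjgM loop_coord_top //.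
  by rewrite jm.
set y := (loop (hurwitz gT N) m j)^-1 x; exists (coord y j * u).
have -> : x = loop (hurwitz gT N) m j y by rewrite permKV.
by rewrite loop_coord_top ?jm // conjgM conjgKV.
Qed.

(** Since [y] ends in 1, the loops fix it, so [x] stays over [y] throughout. Each loop [j]
    conjugates the last entry by a permutation over the inverse of [coord y j], which moves the
    fibre accordingly. *)
Lemma loops_fibre (T : finType) N m a (x : {ffun 'I_N.+1 -> {perm T * bool}})
    (y : {ffun 'I_N.+1 -> {perm T}}) p :
  m <= N -> below m a -> coord y m = 1 ->
  (forall k, k <= N -> lies_over (coord x k) (coord y k)) ->
  moves_only p (coord x m) ->
  moves_only (weval (fun k => (coord y k)^-1) a p)
    (coord (weval (loop (hurwitz _ N) m) a x) m).
Proof.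
move=> mN + y1; elim: a x p => [|l a IHa] x p am xy xp.
  by rewrite !weval_nil !perm1.
have {am} /andP[lm am] := am.
have lm1 : below m [:: l] by rewrite /= lm.
rewrite !weval_cons !permM; set x' := lval (loop (hurwitz _ N) m) l x.
have xy' k : k <= N -> lies_over (coord x' k) (coord y k).
  have [w wm wE] := loops_word lm1.
  rewrite /x' -weval1 -(loops_id mN lm1 y1) !wE.
  apply: hurwitz_rel xy k; [exact: lies_overM|exact: lies_overV|].
  by apply: sub_all wm => i im; apply: leq_trans mN.
apply: IHa => //; rewrite /x' in xy' *.
case: l lm {lm1 x'} xy' => j b /= jm; rewrite /lval /= => xy'.
have jN : j <= N by apply/ltnW/(leq_trans jm).
case: b xy' => xy'.
  rewrite loop_coord_top ?jm //; apply: moves_onlyJ => //.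
  exact/lies_overV/xy.
(* For an inverse loop the conjugating entry is read off the image [z], which also lies over [y]. *)
rewrite invgK; set z := (loop (hurwitz _ N) m j)^-1 x in xy' *.
have := moves_onlyJ (xy' j jN) xp.
have -> : x = loop (hurwitz _ N) m j z by rewrite permKV.
by rewrite loop_coord_top ?jm // conjgKV.
Qed.

(** * Joint faithfulness of the Hurwitz actions *)

(** Induction is on [m] with [N] fixed. Testing only tuples that are trivial above [m] lets the
    inductive step also set entry [m.+1] to 1, which silences the loops. *)
Lemma hurwitz_faithful N m w : m <= N -> below m w ->
  (forall (gT : finGroupType) (x : {ffun 'I_N.+1 -> gT}),
     (forall k, m < k <= N -> coord x k = 1) -> weval (hurwitz gT N) w x = x) ->
  forall (B : groupType) (s : nat -> B), braided m s -> weval s w = 1.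
Proof.
elim: m w => [|m IHm] w mN wm w1.
  by case: w wm {w1} => // _ B s _; rewrite weval_nil.
have [j [a [b [jm am ra bm wE]]]] := comb_word wm; rewrite /= in bm.
have hB (gT : finGroupType) := braidedW mN (hurwitz_braided gT N).
have b_top (gT : finGroupType) (x : {ffun 'I_N.+1 -> gT}) :
    coord (weval (hurwitz gT N) b x) m.+1 = coord x m.+1.
  by apply: hurwitz_fix bm _; [exact: ltnW | rewrite ltnSn].
have jE : j = m.+1.
  apply/eqP; apply: contraT => jm1.
  pose g : {perm bool} := tperm true false.
  (* If [j] were below [m.+1], the carry would bring the only nontrivial entry to the top, where
     loops merely conjugate it; but the top entry of [x] is 1. *)
  pose x := [ffun k : 'I_N.+1 => (if k == j :> nat then g else 1)].
  have xE k : k <= N -> coord x k = if k == j then g else 1.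
    by move=> kN; rewrite /x (coord_ffun (fun k => if k == j then g else 1)).
  have wx : weval (hurwitz _ N) w x = x.
    apply: w1 => k /andP[mk kN]; rewrite xE //.
    by have -> : (k == j) = false by lia.
  have := congr1 (@coord N _ ^~ m.+1) wx; rewrite wE // !permM /= b_top.
  have [u ->] := loops_conj (carry (hurwitz _ N) m.+1 j x) mN am.
  rewrite carry_coord_top ?jm // !xE ?(leq_trans jm) // eqxx.
  rewrite eq_sym (negbTE jm1) => /eqP; rewrite conjg_eq1.
  by move=> /eqP/permP/(_ true); rewrite tpermL perm1.
subst j.
have b1 : forall (B : groupType) (s : nat -> B), braided m s -> weval s b = 1.
  apply: IHm => //; first exact: ltnW.
  move=> gT x x1; have := w1 _ x; rewrite wE // carry_top mul1g permM.
  rewrite loops_id //; last by apply: x1; rewrite ltnSn.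
  by apply => k /andP[mk kN]; apply: x1; rewrite kN andbT ltnW.
suff a0 : a = [::].
  move=> B s sB; rewrite wE // carry_top a0 weval_nil !mul1g.
  exact/b1/(braidedW _ sB).
have [f fa] := reduced_perm ra.
pose swap := tperm (ord0 : 'I_(size a).+1, true) (ord0, false).
pose lift (g : {perm 'I_(size a).+1}) := perm (lift_perm_inj (g := g)).
(* Inverses are taken because loop [k] acts through the inverse of entry [k]; thus [a] is evaluated
   at [f] itself. *)
pose yf k := if k < m.+1 then (f k)^-1 else 1.
pose xf k := if k < m.+1 then lift (f k)^-1 else if k == m.+1 then swap else 1.
pose y := [ffun k : 'I_N.+1 => yf k]; pose x := [ffun k : 'I_N.+1 => xf k].
have yE k (kN : k <= N) : coord y k = yf k := coord_ffun yf kN.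
have xE k (kN : k <= N) : coord x k = xf k := coord_ffun xf kN.
have x_top : coord x m.+1 = swap by rewrite xE // /xf ltnn eqxx.
have y_top : coord y m.+1 = 1 by rewrite yE // /yf ltnn.
have xy k : k <= N -> lies_over (coord x k) (coord y k).
  move=> kN; rewrite xE // yE // /xf /yf.
  case: ltnP => _; first exact: lift_lies_over.
  by case: eqP => _; [exact: swap_lies_over | exact: lies_over1].
have x0 : moves_only ord0 (coord x m.+1).
  by rewrite x_top; exact: swap_moves_only.
have := loops_fibre mN am y_top xy x0.
have -> : weval (fun k => (coord y k)^-1) a = weval f a.
  apply: weval_below_eq am => i im.
  by rewrite yE ?(leq_trans (ltnW im)) // /yf im invgK.
have wx : weval (hurwitz _ N) w x = x.
  apply: w1 => k /andP[mk kN]; rewrite xE // /xf.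
  by have [-> ->] : (k < m.+1 = false) /\ (k == m.+1 = false) by lia.
rewrite wE // carry_top mul1g b1 ?mulg1 in wx; last exact: braidedW (hB _).
(* The last entry is unchanged, so it moves only the fibre over [ord0], yet [a] has taken it to the
   one over [ord_max]. Hence [size a] is 0. *)
rewrite wx fa => /(moves_only_uniq x0)/(congr1 val) /= /esym.
exact: size0nil.
Qed.

(** * Evaluating words of the presentation and of the normal closure *)

Definition nat_word n (w : word n) : seq sletter :=
  [seq (nat_of_ord l.1, l.2) | l <- w].

Lemma nat_word_below n (w : word n) : below n.-1 (nat_word w).
Proof. by apply/allP => _ /mapP[l _ ->] /=. Qed.

Lemma nat_word_inv n (w : word n) :
  nat_word (inv_word w) = rev (map flip (nat_word w)).
Proof. by rewrite /nat_word /inv_word map_rev -!map_comp. Qed.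

Lemma weval_braid_eq n (B : groupType) (s : nat -> B) (u v : word n) :
  braided n.-1 s -> braid_eq u v -> weval s (nat_word u) = weval s (nat_word v).
Proof.
move=> [sb sc]; elim=> // [{}u {}v w _ -> _ -> //|{}u {}v r r' rr'].
rewrite /nat_word !map_cat !weval_cat; congr (_ * (_ * _)).
case: rr' => [[i b]|i j ij|i j ij] /=; rewrite !weval_cons weval_nil !mulg1.
- by rewrite -[X in _ * X]/(lval s (flip (i : nat, b))) lval_flip mulgV.
- by rewrite /lval /= ij !mulgA sb // -ij.
- by rewrite /lval /= sc // ij /=.
Qed.

Lemma weval_ncl n k (B : groupType) (s : nat -> B) (w : word n) :
  (forall x : B, x ^+ k = 1) -> ncl_word k w -> weval s (nat_word w) = 1.
Proof.
move=> Bk; elim=> [|u {}w i b _ IHw]; first exact: weval_nil.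
rewrite /nat_word !map_cat !weval_cat -!/(nat_word _) nat_word_inv weval_inv IHw.
suff -> : weval s (nat_word (nseq k (i, b))) = 1 by rewrite mul1g mulg1 mulgV.
rewrite /nat_word map_nseq -(Bk (lval s (i : nat, b))).
elim: k {Bk} => [|k IHk] /=; first exact: weval_nil.
by rewrite weval_cons IHk expgS.
Qed.

(** * The braid group as a quotient of words *)

Lemma braid_eq_cat n (u u' v v' : word n) :
  braid_eq u u' -> braid_eq v v' -> braid_eq (u ++ v) (u' ++ v').
Proof.
move=> uu' vv'; apply: (@be_trans _ _ (u' ++ v)).
  elim: uu' => [w|x y _|x y z _ xy _|x y r r' rr']; first exact: be_refl.
  - exact: be_sym.
  - exact: be_trans.
  - by rewrite -!catA; exact: be_step.
elim: vv' => [w|x y _|x y z _ xy _|x y r r' rr']; first exact: be_refl.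
- exact: be_sym.
- exact: be_trans.
- by rewrite !(catA u'); exact: be_step.
Qed.

Lemma inv_wordK n : involutive (@inv_word n).
Proof.
move=> w; rewrite /inv_word map_rev revK -map_comp map_id_in // => -[i b] _.
by rewrite /= /inv_letter /= negbK.
Qed.

Lemma braid_eq_mulV n (w : word n) : braid_eq (w ++ inv_word w) [::].
Proof.
elim: w => [|l w IHw]; first exact: be_refl.
have -> : (l :: w) ++ inv_word (l :: w) =
    [:: l] ++ (w ++ inv_word w) ++ [:: inv_letter l].
  by rewrite /inv_word map_cons rev_cons -cats1 -!catA.
apply: (@be_trans _ _ ([:: l] ++ [::] ++ [:: inv_letter l])).
  apply: braid_eq_cat; first exact: be_refl.
  by apply: braid_eq_cat; last exact: be_refl.
exact: (be_step [::] [::] (br_free l)).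
Qed.

Lemma braid_eq_inv n (u v : word n) :
  braid_eq u v -> braid_eq (inv_word u) (inv_word v).
Proof.
move=> uv; have e1 := braid_eq_mulV v.
have e2 : braid_eq (inv_word u ++ u) [::].
  by have := braid_eq_mulV (inv_word u); rewrite inv_wordK.
apply: (@be_trans _ _ (inv_word u ++ (v ++ inv_word v))).
  rewrite -{1}(cats0 (inv_word u)); apply: braid_eq_cat; first exact: be_refl.
  exact: be_sym.
apply: (@be_trans _ _ ((inv_word u ++ u) ++ inv_word v)).
  rewrite catA; apply: braid_eq_cat; last exact: be_refl.
  by apply: braid_eq_cat; [exact: be_refl | exact: be_sym].
by rewrite -[X in braid_eq _ X]cat0s; apply: braid_eq_cat; last exact: be_refl.
Qed.

(** The classical truth value turns the congruence into the boolean relation required by the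
    quotient construction. *)
Definition braid_eqb n (u v : word n) : bool := `[< braid_eq u v >].

Lemma braid_eqb_refl n : reflexive (@braid_eqb n).
Proof. by move=> u; apply/asboolP; exact: be_refl. Qed.

Lemma braid_eqb_sym n : symmetric (@braid_eqb n).
Proof. by move=> u v; apply/asboolP/asboolP; exact: be_sym. Qed.

Lemma braid_eqb_trans n : transitive (@braid_eqb n).
Proof.
by move=> v u w /asboolP uv /asboolP vw; apply/asboolP; exact: be_trans vw.
Qed.

Canonical braid_equiv n :=
  EquivRel (@braid_eqb n) (@braid_eqb_refl n) (@braid_eqb_sym n)
    (@braid_eqb_trans n).

Definition braid_group n := {eq_quot (braid_equiv n)}.

HB.instance Definition _ n := Choice.on (braid_group n).

Definition braid_class n (w : word n) : braid_group n := \pi w.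

Lemma braid_classP n (u v : word n) :
  braid_class u = braid_class v <-> braid_eq u v.
Proof.
split=> [/eqmodP/asboolP //|uv].
by apply/eqmodP/asboolP.
Qed.

Lemma braid_classK n (x : braid_group n) : braid_class (repr x) = x.
Proof. exact: reprK. Qed.

Definition braid_mul n (x y : braid_group n) : braid_group n :=
  braid_class (repr x ++ repr y).

Definition braid_inv n (x : braid_group n) : braid_group n :=
  braid_class (inv_word (repr x)).

Lemma braid_mulE n (u v : word n) :
  braid_mul (braid_class u) (braid_class v) = braid_class (u ++ v).
Proof.
by apply/braid_classP/braid_eq_cat; apply/braid_classP; exact: braid_classK.
Qed.

Lemma braid_invE n (u : word n) :
  braid_inv (braid_class u) = braid_class (inv_word u).
Proof. by apply/braid_classP/braid_eq_inv/braid_classP; exact: braid_classK. Qed.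

Lemma braid_mulA n : associative (@braid_mul n).
Proof.
move=> x y z; rewrite -[x]braid_classK -[y]braid_classK -[z]braid_classK.
by rewrite !braid_mulE catA.
Qed.

Lemma braid_mul1 n : left_id (braid_class [::]) (@braid_mul n).
Proof. by move=> x; rewrite -[x]braid_classK braid_mulE. Qed.

Lemma braid_mulr1 n : right_id (braid_class [::]) (@braid_mul n).
Proof. by move=> x; rewrite -[x]braid_classK braid_mulE cats0. Qed.

Lemma braid_mulV n : right_inverse (braid_class [::]) (@braid_inv n) (@braid_mul n).
Proof.
move=> x; rewrite -[x]braid_classK braid_invE braid_mulE.
exact/braid_classP/braid_eq_mulV.
Qed.

Lemma braid_Vmul n : left_inverse (braid_class [::]) (@braid_inv n) (@braid_mul n).
Proof.
move=> x; rewrite -[x]braid_classK braid_invE braid_mulE.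
by apply/braid_classP; rewrite -{2}(inv_wordK (repr x)); exact: braid_eq_mulV.
Qed.

HB.instance Definition _ n := isGroup.Build (braid_group n)
  (@braid_mulA n) (@braid_mul1 n) (@braid_mulr1 n) (@braid_Vmul n) (@braid_mulV n).

Definition braid_gen n : nat -> braid_group n :=
  extend (fun i : 'I_n.-1 => braid_class [:: (i, true)]).

Lemma braid_gen_ord n (i : 'I_n.-1) : braid_gen n i = braid_class [:: (i, true)].
Proof. exact: extend_ord. Qed.

Lemma braid_gen_braided n : braided n.-1 (braid_gen n).
Proof.
split=> [i im|i j /andP[ij jm]].
  rewrite -[i]/(val (Ordinal (ltnW im))) -[i.+1]/(val (Ordinal im)) !braid_gen_ord.
  rewrite -![_ * _]/(braid_mul _ _) !braid_mulE /=; apply/braid_classP.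
  exact: (be_step [::] [::] (br_braid _)).
have im : i < n.-1 by lia.
rewrite -[i]/(val (Ordinal im)) -[j]/(val (Ordinal jm)) !braid_gen_ord.
rewrite -![_ * _]/(braid_mul _ _) !braid_mulE /=; apply/braid_classP.
exact: (be_step [::] [::] (br_comm _)).
Qed.

Lemma weval_braid_gen n (w : word n) :
  weval (braid_gen n) (nat_word w) = braid_class w.
Proof.
elim: w => [|[i b] w IHw]; first exact: weval_nil.
rewrite /= weval_cons IHw /lval /= -cat1s -braid_mulE braid_gen_ord.
by case: b => //; rewrite -[_^-1]/(braid_inv _) braid_invE.
Qed.

Theorem theorem1p1 (n : nat) (hn : 2 <= n) (w : word n) :
  (forall k : nat, 1 <= k -> in_Bnk k w) -> braid_eq w [::].
Proof.
move=> wk; apply/braid_classP; rewrite -weval_braid_gen.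
(* With [m] and [N] both [n.-1], no coordinate lies above [m], so every tuple is tested. *)
apply: (hurwitz_faithful (leqnn n.-1) (nat_word_below w)) (braid_gen_braided n).
move=> gT x _; pose P := {perm {ffun 'I_n.-1.+1 -> gT}}.
(* The order of the finite permutation group is an exponent for it, so with this [k] the normal
   closure acts trivially. *)
have [w' [ww' w'k]] := wk #|[set: P]| (cardG_gt0 _).
rewrite (weval_braid_eq (hurwitz_braided gT n.-1) ww') (weval_ncl _ _ w'k) ?perm1 //.
by move=> p; exact/expg_cardG/in_setT.
Qed.
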